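(* Let $\Gamma$ be a finite group. Let $x,y$ be elements of $\Gamma_\infty$ of modified types $\lambda$ and $\mu$, and let $xy$ be of modified type $\nu$. Then $\|xy\|\le\|x\|+\|y\|$, or equivalently, $\|\nu\|\le\|\lambda\|+\|\mu\|$.
   Context: $\Gamma_*$ is the set of conjugacy classes of $\Gamma$, and $c^0=\{1\}$. $S_n$ acts on $\Gamma^n$ by $\sigma(g_1,\dots,g_n)=(g_{\sigma^{-1}(1)},\dots,g_{\sigma^{-1}(n)})$, and $\Gamma_n=\Gamma^n\rtimes S_n$ with $(g,\sigma)(h,\tau)=(g\,\sigma(h),\sigma\tau)$. $\Gamma_n$ embeds in $\Gamma_{n+1}$ as $\Gamma_n\times1$, and $\Gamma_\infty=\bigcup_{n\ge1}\Gamma_n$. For $x=(g,\sigma)$ and a cycle $(i_1\cdots i_k)$ of $\sigma$ (fixed points are 1-cycles), the cycle-product is $g_{i_k}\cdots g_{i_1}$, well defined up to conjugacy. For a partition-valued function $\lambda$ on $\Gamma_*$, $\|\lambda\|=\sum_c|\lambda(c)|$. The type $\rho$ of $x\in\Gamma_n$: the number of parts of $\rho(c)$ equal to $i$ is the number of $i$-cycles of $\sigma$ with cycle-product in $c$. The modified type $\lambda$: $\lambda(c)=\rho(c)$ for $c\ne c^0$, and $\lambda(c^0)$ is obtained from $\rho(c^0)$ by subtracting 1 from every part (zeros discarded); it does not depend on $n$ with $x\in\Gamma_n$. The degree of $x$ is $\|x\|=\|\lambda\|$, where $\lambda$ is the modified type of $x$. *)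

(* Defs.v *)
From HB Require Import structures.
From mathcomp Require Import all_boot all_fingroup.
From mathcomp Require Import generic_quotient.

Set Implicit Arguments.
Unset Strict Implicit.
Unset Printing Implicit Defensive.

Import GroupScope.

Definition is_partition (s : seq nat) := sorted geq s && (0 \notin s).

Record partition_of_nat :=
  Partition { parts :> seq nat; partsP : is_partition parts }.

HB.instance Definition _ := [isSub for parts].
HB.instance Definition _ := [Choice of partition_of_nat by <:].

Fact mkpart_subproof s : is_partition (sort geq [seq k <- s | 0 < k]).
Proof.
rewrite /is_partition sort_sorted /=; last by move=> a b; exact: leq_total.
by rewrite mem_sort mem_filter.
Qed.
Definition mkpart (s : seq nat) := Partition (mkpart_subproof s).

Lemma partition_eq (s t : partition_of_nat) :
  (forall k, 0 < k -> count_mem k s = count_mem k t) -> s = t.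
Proof.
move=> eq_st; apply: val_inj; have /andP[ss s0] := partsP s.
have /andP[st t0] := partsP t.
have geq_anti : antisymmetric geq.
  by move=> a b; rewrite andbC => /anti_leq.
have geq_trans : transitive geq by move=> a b c ba ac; exact: leq_trans ac ba.
apply: (sorted_eq geq_trans geq_anti ss st); apply/allP=> -[|k] _ /=.
  by rewrite (count_memPn s0) (count_memPn t0).
by apply/eqP/eq_st.
Qed.

Lemma count_enum_set (T : finType) (A : {set T}) (p : pred T) :
  count p (enum A) = #|[set C in A | p C]|.
Proof.
rewrite -size_filter cardE; apply: perm_size; apply: uniq_perm.
- by rewrite filter_uniq ?enum_uniq.
- exact: enum_uniq.
by move=> C; rewrite mem_filter !mem_enum inE andbC.
Qed.

Definition conjclass (gT : finGroupType) :=
  {c : {set gT} | c \in classes [set: gT]}.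

Definition partfun (gT : finGroupType) :=
  {ffun conjclass gT -> partition_of_nat}.

Definition pnorm (gT : finGroupType) (l : partfun gT) : nat :=
  \sum_(c : conjclass gT) sumn (l c).

Record wreath (gT : finGroupType) (n : nat) :=
  Wreath { wcoord : {ffun 'I_n -> gT}; wperm : {perm 'I_n} }.

Section Wreath.
Variables (gT : finGroupType) (n : nat).
Implicit Types x y z : wreath gT n.

Definition wreath_pair x := (wcoord x, wperm x).
Definition pair_wreath p : wreath gT n := Wreath p.1 p.2.
Lemma wreath_pairK : cancel wreath_pair pair_wreath. Proof. by case. Qed.
HB.instance Definition _ := Finite.copy (wreath gT n) (can_type wreath_pairK).

(* The product of {perm _} composes from left to right, (s * t) i = t (s i);
   the product sigma tau below is composition from right to left, which makes
   sigma(g)_i = g_(sigma^-1 i) a left action. *)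
Definition wmul x y : wreath gT n :=
  Wreath [ffun i => wcoord x i * wcoord y ((wperm x)^-1 i)]
         (wperm y * wperm x).
Definition wone : wreath gT n := Wreath [ffun => 1] 1.
Definition winv x : wreath gT n :=
  Wreath [ffun i => (wcoord x (wperm x i))^-1] (wperm x)^-1.

Lemma wmulA : associative wmul.
Proof.
move=> [g s] [h t] [k u]; congr Wreath; rewrite /= ?mulgA //.
by apply/ffunP=> i; rewrite !ffunE mulgA invMg permM.
Qed.

Lemma wmul1 : left_id wone wmul.
Proof.
move=> [g s]; congr Wreath; rewrite /= ?mulg1 //.
by apply/ffunP=> i; rewrite !ffunE invg1 perm1 mul1g.
Qed.

Lemma wmulV : left_inverse wone winv wmul.
Proof.
move=> [g s]; congr Wreath; rewrite /= ?mulgV //.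
by apply/ffunP=> i; rewrite !ffunE invgK mulVg.
Qed.

HB.instance Definition _ :=
  Finite_isGroup.Build (wreath gT n) wmulA wmul1 wmulV.

Lemma wcoordM x y i :
  wcoord (x * y) i = wcoord x i * wcoord y ((wperm x)^-1 i).
Proof. by rewrite ffunE. Qed.

Lemma wpermM x y : wperm (x * y) = wperm y * wperm x.
Proof. by []. Qed.

End Wreath.

Section Embed.
Variable gT : finGroupType.

Section Def.
Variables (m n : nat) (le_mn : m <= n).
Implicit Types x y : wreath gT m.

Definition embed_fun (f : 'I_m -> 'I_m) (i : 'I_n) : 'I_n :=
  if insub (i : nat) is Some j then widen_ord le_mn (f j) else i.

Lemma embed_fun_widen f j :
  embed_fun f (widen_ord le_mn j) = widen_ord le_mn (f j).
Proof. by rewrite /embed_fun /= valK. Qed.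

Lemma embed_fun_id f (i : 'I_n) : m <= i -> embed_fun f i = i.
Proof. by move=> le_mi; rewrite /embed_fun insubF // ltnNge le_mi. Qed.

Lemma widen_ordP (i : 'I_n) : i < m -> {j : 'I_m | i = widen_ord le_mn j}.
Proof. by move=> lt_im; exists (Ordinal lt_im); apply: val_inj. Qed.

Lemma embed_funK (s : {perm 'I_m}) : cancel (embed_fun s) (embed_fun s^-1).
Proof.
move=> i; have [/widen_ordP[j ->]|le_mi] := ltnP i m.
  by rewrite !embed_fun_widen permK.
by rewrite !embed_fun_id.
Qed.

Definition embed_perm s : {perm 'I_n} := perm (can_inj (embed_funK s)).

Definition embed x : wreath gT n :=
  Wreath [ffun i : 'I_n => oapp (wcoord x) 1 (insub (i : nat))]
         (embed_perm (wperm x)).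

Lemma embed_perm_widen s j :
  embed_perm s (widen_ord le_mn j) = widen_ord le_mn (s j).
Proof. by rewrite permE embed_fun_widen. Qed.

Lemma embed_perm_id s (i : 'I_n) : m <= i -> embed_perm s i = i.
Proof. by move=> le_mi; rewrite permE embed_fun_id. Qed.

Lemma embed_permV s : (embed_perm s)^-1 = embed_perm s^-1.
Proof.
apply/permP=> i; apply: (@perm_inj _ (embed_perm s)); rewrite permKV.
have [/widen_ordP[j ->]|le_mi] := ltnP i m.
  by rewrite !embed_perm_widen permKV.
by rewrite !embed_perm_id.
Qed.

Lemma embed_coord_widen x j :
  wcoord (embed x) (widen_ord le_mn j) = wcoord x j.
Proof. by rewrite ffunE /= valK. Qed.

Lemma embed_coord1 x (i : 'I_n) : m <= i -> wcoord (embed x) i = 1.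
Proof. by move=> le_mi; rewrite ffunE insubF // ltnNge le_mi. Qed.

Lemma embedM : {morph embed : x y / x * y >-> x * y}.
Proof.
move=> x y; apply: (can_inj (@wreath_pairK _ _)); congr pair.
  apply/ffunP=> i; rewrite wcoordM embed_permV.
  have [/widen_ordP[j ->]|le_mi] := ltnP i m.
    by rewrite embed_perm_widen !embed_coord_widen wcoordM.
  by rewrite embed_perm_id // !embed_coord1 // mulg1.
apply/permP=> i; rewrite permM.
have [/widen_ordP[j ->]|le_mi] := ltnP i m.
  by rewrite !embed_perm_widen permM.
by rewrite !embed_perm_id.
Qed.

Lemma embed1 : embed 1 = 1.
Proof. by apply: (mulgI (embed 1)); rewrite -embedM !mulg1. Qed.

Lemma embedV x : embed x^-1 = (embed x)^-1.
Proof. by apply: (mulgI (embed x)); rewrite -embedM !mulgV embed1. Qed.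

Lemma widen_ord_inj : injective (widen_ord le_mn).
Proof. by move=> i j /(congr1 val) /= /val_inj. Qed.

Lemma embed_inj : injective embed.
Proof.
move=> x y eq_xy; apply: (can_inj (@wreath_pairK _ _)); congr pair.
  by apply/ffunP=> j; rewrite -!embed_coord_widen eq_xy.
apply/permP=> j; apply: widen_ord_inj.
by rewrite -!embed_perm_widen; case: eq_xy => _ ->.
Qed.

End Def.

Lemma embed_trans m n p (le_mn : m <= n) (le_np : n <= p) (le_mp : m <= p) x :
  embed le_np (embed le_mn x) = embed le_mp x.
Proof.
apply: (can_inj (@wreath_pairK _ _)); congr pair; last apply/permP => i.
  apply/ffunP=> i; have [lt_im|le_mi] := ltnP i m.
    have [j ->] := widen_ordP le_mp lt_im; rewrite embed_coord_widen.
    rewrite (_ : widen_ord le_mp j = widen_ord le_np (widen_ord le_mn j)).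
      by rewrite !embed_coord_widen.
    exact: val_inj.
  rewrite (embed_coord1 le_mp) //.
  have [lt_in|le_ni] := ltnP i n; last by rewrite embed_coord1.
  have [j def_i] := widen_ordP le_np lt_in.
  by rewrite def_i embed_coord_widen embed_coord1 //; move: le_mi; rewrite def_i.
have [lt_im|le_mi] := ltnP i m.
  have [j ->] := widen_ordP le_mp lt_im; rewrite embed_perm_widen.
  rewrite (_ : widen_ord le_mp j = widen_ord le_np (widen_ord le_mn j)).
    by rewrite !embed_perm_widen; apply: val_inj.
  exact: val_inj.
rewrite [RHS]embed_perm_id //.
have [lt_in|le_ni] := ltnP i n; last by rewrite embed_perm_id.
have [j def_i] := widen_ordP le_np lt_in.
by rewrite def_i embed_perm_widen embed_perm_id //; move: le_mi; rewrite def_i.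
Qed.

Lemma embed_id n (le_nn : n <= n) x : embed le_nn x = x.
Proof. by apply: (@embed_inj _ _ le_nn); rewrite embed_trans. Qed.

End Embed.

Section Types.
Variables (gT : finGroupType) (n : nat).
Implicit Types (x : wreath gT n) (c : conjclass gT) (C : {set 'I_n}).

(* For the cycle (i_1 ... i_k) of sigma with i_1 = i and sigma i_j = i_(j+1),
   this is g_(i_k) * ... * g_(i_1). *)
Definition cycle_prod x (i : 'I_n) : gT :=
  \prod_(j <- rev (traject (wperm x) i #|porbit (wperm x) i|)) wcoord x j.

Lemma cycle_prod_perm x i :
  cycle_prod x (wperm x i) = cycle_prod x i ^ (wcoord x i)^-1.
Proof.
have eqP := porbit_perm (wperm x) 1 i; rewrite expg1 in eqP.
rewrite /cycle_prod eqP; have := iter_porbit (wperm x) i.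
case: #|_| (card_porbit_neq0 (wperm x) i) => // k _ itk.
rewrite [in RHS]trajectS rev_cons trajectSr rev_rcons -iterSr itk.
by rewrite big_cons -cats1 big_cat /= big_seq1 conjgE invgK !mulgA mulgK.
Qed.

Lemma cycle_prod_class x i j c : j \in porbit (wperm x) i ->
  (cycle_prod x j \in val c) = (cycle_prod x i \in val c).
Proof.
move=> /porbitP[k ->]; elim: k => [|k IHk]; first by rewrite perm1.
rewrite expgSr permM cycle_prod_perm -IHk; have /imsetP[g _ ->] := valP c.
by apply: class_transl; rewrite memJ_class ?inE.
Qed.

(* The cycles of x with cycle-product in c; by cycle_prod_class the choice of
   the starting point i in C is immaterial. *)
Definition cycles_in x c : {set {set 'I_n}} :=
  [set C in porbits (wperm x) | [exists i in C, cycle_prod x i \in val c]].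

Definition wtype x : partfun gT :=
  [ffun c => mkpart [seq #|C| | C : {set 'I_n} <- enum (cycles_in x c)]].

(* The test holds exactly for c^0; mkpart discards the zeros. *)
Definition wmodtype x : partfun gT :=
  [ffun c => if val c == [set 1] then mkpart [seq k.-1 | k : nat <- wtype x c]
             else wtype x c].

Lemma mem_cycles_in x c i :
  (porbit (wperm x) i \in cycles_in x c) = (cycle_prod x i \in val c).
Proof.
rewrite inE imset_f //=; apply/exists_inP/idP => [[j ij]|ic].
  by rewrite (cycle_prod_class c ij).
by exists i => //; exact: porbit_id.
Qed.

Lemma count_wtype x c k : 0 < k ->
  count_mem k (wtype x c) = #|[set C in cycles_in x c | #|C| == k]|.
Proof.
move=> k_gt0; rewrite ffunE /= count_sort count_filter count_map.
rewrite -count_enum_set; apply: eq_count => C /=.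
by case: eqP => // ->; rewrite k_gt0.
Qed.

Lemma count_wmodtype x c k : 0 < k ->
  count_mem k (wmodtype x c)
    = #|[set C in cycles_in x c | #|C| - (val c == [set 1%g]) == k]|.
Proof.
move=> k_gt0; rewrite ffunE; case: eqP => _; last first.
  by rewrite count_wtype //; apply: eq_card => C; rewrite !inE subn0.
transitivity (count_mem k.+1 (wtype x c)).
  rewrite count_sort count_filter count_map; apply: eq_count => -[|j] /=.
    by case: eqP k_gt0 => // <-.
  by rewrite eqSS; case: eqP => // ->; rewrite k_gt0.
rewrite count_wtype //; apply: eq_card => C; rewrite !inE.
congr andb; rewrite subn1; case: #|C| => [|j] //=.
by case: k k_gt0.
Qed.

End Types.

Section EmbedTypes.
Variables (gT : finGroupType) (m n : nat) (le_mn : m <= n).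
Implicit Types (x : wreath gT m) (s : {perm 'I_m}) (c : conjclass gT).

Let w := widen_ord le_mn.

Lemma embed_permX s k j :
  (embed_perm le_mn s ^+ k) (w j) = w ((s ^+ k) j).
Proof.
by elim: k => [|k IHk]; rewrite ?perm1 // !expgSr !permM IHk embed_perm_widen.
Qed.

Lemma porbit_embed s j : porbit (embed_perm le_mn s) (w j) = w @: porbit s j.
Proof.
apply/setP=> i; apply/porbitP/imsetP => [[k ->]|[_ /porbitP[k ->] ->]].
  by exists ((s ^+ k) j); rewrite ?mem_porbit ?embed_permX.
by exists k; rewrite embed_permX.
Qed.

Lemma porbit_embed1 s (i : 'I_n) : m <= i ->
  porbit (embed_perm le_mn s) i = [set i].
Proof.
move=> le_mi; apply/setP=> j; rewrite inE; apply/porbitP/eqP => [[k ->]|->].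
  by elim: k => [|k IHk]; rewrite ?perm1 // expgSr permM IHk embed_perm_id.
by exists 0; rewrite perm1.
Qed.

Lemma cycle_prod_embed x j :
  cycle_prod (embed le_mn x) (w j) = cycle_prod x j.
Proof.
rewrite /cycle_prod porbit_embed card_imset; last exact: widen_ord_inj.
have -> k : traject (embed_perm le_mn (wperm x)) (w j) k
          = map w (traject (wperm x) j k).
  by elim: k j => //= k IHk j; rewrite embed_perm_widen IHk.
rewrite -map_rev big_map; apply: eq_bigr => i _; exact: embed_coord_widen.
Qed.

Lemma cycle_prod_embed1 x (i : 'I_n) : m <= i ->
  cycle_prod (embed le_mn x) i = 1.
Proof.
move=> le_mi; rewrite /cycle_prod porbit_embed1 // cards1 /=.
by rewrite big_seq1 embed_coord1.
Qed.

Lemma wmodtype_embed x : wmodtype (embed le_mn x) = wmodtype x.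
Proof.
apply/ffunP=> c; apply: partition_eq => k k_gt0; rewrite !count_wmodtype //.
have w_inj : injective w by exact: widen_ord_inj.
rewrite -(card_imset _ (imset_inj w_inj)); apply: eq_card => C.
rewrite [LHS]inE; apply/idP/imsetP => [/andP[Cin Ck]|[D + ->]]; last first.
  rewrite inE => /andP[Din Dk]; have := Din.
  rewrite inE => /andP[/imsetP[j _ def_D] _]; rewrite card_imset // Dk andbT.
  have -> : w @: D = porbit (wperm (embed le_mn x)) (w j).
    by rewrite def_D porbit_embed.
  by rewrite mem_cycles_in cycle_prod_embed -mem_cycles_in -def_D.
have := Cin; rewrite inE => /andP[/imsetP[i _ def_C] _].
move: Cin Ck; rewrite def_C mem_cycles_in.
have [/(widen_ordP le_mn)[j ->]|le_mi] := ltnP i m.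
  rewrite cycle_prod_embed porbit_embed card_imset // => jc jk.
  by exists (porbit (wperm x) j); rewrite // inE mem_cycles_in jc.
rewrite cycle_prod_embed1 // porbit_embed1 // cards1 => c1.
have /imsetP[g _ def_c] := valP c; move: c1; rewrite def_c => c1.
by rewrite -(class_eqP c1) class1G eqxx; case: k k_gt0.
Qed.

End EmbedTypes.

Section WreathInf.
Variable gT : finGroupType.

(* Gamma_oo is the union of the Gamma_n for n >= 1, hence the successor; two
   elements of finite level are identified when their images in a common
   Gamma_N agree. *)
Definition fin_level := {n : nat & wreath gT n.+1}.
Implicit Types u v w : fin_level.

Definition lift_to N u (le_uN : tag u < N) : wreath gT N :=
  embed le_uN (tagged u).

Definition same_elt u v : bool :=
  let N := maxn (tag u) (tag v) in
  embed (leq_maxl (tag u) (tag v) : (tag u).+1 <= N.+1) (tagged u)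
    == embed (leq_maxr (tag u) (tag v) : (tag v).+1 <= N.+1) (tagged v).

Lemma same_eltE u v N (le_uN : tag u < N) (le_vN : tag v < N) :
  same_elt u v = (lift_to le_uN == lift_to le_vN).
Proof.
have le_mN : (maxn (tag u) (tag v)).+1 <= N by rewrite gtn_max le_uN le_vN.
rewrite /same_elt /lift_to -(inj_eq (@embed_inj _ _ _ le_mN)).
by rewrite (embed_trans _ _ le_uN) (embed_trans _ _ le_vN).
Qed.

Lemma same_elt_refl : reflexive same_elt.
Proof. by move=> u; rewrite (same_eltE (leqnn _) (leqnn _)). Qed.

Lemma same_elt_sym : symmetric same_elt.
Proof.
move=> u v; have lu := leq_addr (tag v) (tag u).+1.
have lv : tag v < (tag u).+1 + tag v by rewrite addSn ltnS leq_addl.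
by rewrite (same_eltE lu lv) (same_eltE lv lu) eq_sym.
Qed.

Lemma same_elt_trans : transitive same_elt.
Proof.
move=> v u w; pose N := (tag u + tag v + tag w).+1.
have lu : tag u < N by rewrite ltnS -addnA leq_addr.
have lv : tag v < N by rewrite ltnS addnAC leq_addl.
have lw : tag w < N by rewrite ltnS leq_addl.
rewrite (same_eltE lu lv) (same_eltE lv lw) (same_eltE lu lw).
by move=> /eqP-> /eqP->.
Qed.

Canonical same_elt_equiv :=
  EquivRel same_elt same_elt_refl same_elt_sym same_elt_trans.

Definition wreath_inf := {eq_quot same_elt}%qT.
HB.instance Definition _ := Choice.on wreath_inf.

Definition of_wreath n (x : wreath gT n.+1) : wreath_inf :=
  (\pi_wreath_inf (Tagged (fun n => wreath gT n.+1) x))%qT.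

Lemma of_wreath_eq m n (x : wreath gT m.+1) (y : wreath gT n.+1) N
    (le_mN : m < N) (le_nN : n < N) :
  (of_wreath x == of_wreath y) = (embed le_mN x == embed le_nN y).
Proof.
rewrite /of_wreath -(@same_eltE (Tagged (fun n => wreath gT n.+1) x)
  (Tagged (fun n => wreath gT n.+1) y)).
by apply/eqP/idP => [/eqmodP|/eqmodP].
Qed.

Lemma of_wreath_embed m n (le_mn : m < n.+1) (x : wreath gT m.+1) :
  of_wreath (embed le_mn x) = of_wreath x.
Proof.
by apply/eqP; rewrite (of_wreath_eq _ _ (leqnn n.+1) le_mn) embed_trans.
Qed.

Lemma of_wreath_inj n : injective (@of_wreath n).
Proof.
move=> x y /eqP; rewrite (of_wreath_eq _ _ (leqnn n.+1) (leqnn n.+1)).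
by move/eqP/embed_inj.
Qed.

Lemma of_wreathP (x : wreath_inf) :
  {n : nat & {y : wreath gT n.+1 | x = of_wreath y}}.
Proof.
exists (tag (repr x)), (tagged (repr x)).
by rewrite /of_wreath -[LHS]reprK; case: (repr x).
Qed.

(* The choice of representatives is immaterial, by inf_mulE. *)
Definition inf_mul (x y : wreath_inf) : wreath_inf :=
  let u := repr x in let v := repr y in
  let N := maxn (tag u) (tag v) in
  of_wreath (embed (leq_maxl (tag u) (tag v) : (tag u).+1 <= N.+1) (tagged u)
           * embed (leq_maxr (tag u) (tag v) : (tag v).+1 <= N.+1) (tagged v)).

Definition inf_one : wreath_inf := of_wreath (1 : wreath gT 1).

Definition inf_inv (x : wreath_inf) : wreath_inf :=
  of_wreath (tagged (repr x))^-1.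

Lemma of_wreath_repr (x : wreath_inf) : of_wreath (tagged (repr x)) = x.
Proof. by rewrite -[RHS]reprK /of_wreath; case: (repr x). Qed.

Lemma inf_mulE n (x y : wreath gT n.+1) :
  inf_mul (of_wreath x) (of_wreath y) = of_wreath (x * y).
Proof.
rewrite /inf_mul; set u := repr _; set v := repr _; set N := maxn _ _.
have := of_wreath_repr (of_wreath x); rewrite -/u => /eqP.
have := of_wreath_repr (of_wreath y); rewrite -/v => /eqP.
have lN : N < (N + n).+1 by rewrite ltnS leq_addr.
have ln : n < (N + n).+1 by rewrite ltnS leq_addl.
have lu : tag u < (N + n).+1 by apply: leq_trans lN; rewrite ltnS leq_maxl.
have lv : tag v < (N + n).+1 by apply: leq_trans lN; rewrite ltnS leq_maxr.
rewrite (of_wreath_eq _ _ lu ln) (of_wreath_eq _ _ lv ln) => /eqP ey /eqP ex.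
apply/eqP; rewrite (of_wreath_eq _ _ lN ln) !embedM.
by rewrite (embed_trans _ _ lu) (embed_trans _ _ lv) ex ey.
Qed.

Lemma inf_invE n (x : wreath gT n.+1) :
  inf_inv (of_wreath x) = of_wreath x^-1.
Proof.
rewrite /inf_inv; set u := repr _.
have := of_wreath_repr (of_wreath x); rewrite -/u => /eqP.
have ln : n < (tag u + n).+1 by rewrite ltnS leq_addl.
have lu : tag u < (tag u + n).+1 by rewrite ltnS leq_addr.
rewrite (of_wreath_eq _ _ lu ln) => /eqP ex.
by apply/eqP; rewrite (of_wreath_eq _ _ lu ln) !embedV ex.
Qed.

Lemma inf_oneE n : inf_one = of_wreath (1 : wreath gT n.+1).
Proof. by rewrite -(embed1 _ (ltn0Sn n)) of_wreath_embed. Qed.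

Lemma of_wreath3 (x y z : wreath_inf) : exists n,
  exists x' y' z' : wreath gT n.+1,
  [/\ x = of_wreath x', y = of_wreath y' & z = of_wreath z'].
Proof.
have [[m [x' ->]] [n [y' ->]]] := (of_wreathP x, of_wreathP y).
have [p [z' ->]] := of_wreathP z; pose N := m + n + p.
have lm : m < N.+1 by rewrite ltnS /N -addnA leq_addr.
have ln : n < N.+1 by rewrite ltnS /N addnAC leq_addl.
have lp : p < N.+1 by rewrite ltnS leq_addl.
by exists N, (embed lm x'), (embed ln y'), (embed lp z'); rewrite !of_wreath_embed.
Qed.

Lemma inf_mulA : associative inf_mul.
Proof.
move=> x y z; have [n [x' [y' [z' [-> -> ->]]]]] := of_wreath3 x y z.
by rewrite !inf_mulE mulgA.
Qed.

Lemma inf_mul1 : left_id inf_one inf_mul.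
Proof.
by move=> x; have [n [y ->]] := of_wreathP x; rewrite (inf_oneE n) inf_mulE mul1g.
Qed.

Lemma inf_mulx1 : right_id inf_one inf_mul.
Proof.
by move=> x; have [n [y ->]] := of_wreathP x; rewrite (inf_oneE n) inf_mulE mulg1.
Qed.

Lemma inf_mulV : left_inverse inf_one inf_inv inf_mul.
Proof.
move=> x; have [n [y ->]] := of_wreathP x.
by rewrite inf_invE inf_mulE mulVg (inf_oneE n).
Qed.

Lemma inf_mulxV : right_inverse inf_one inf_inv inf_mul.
Proof.
move=> x; have [n [y ->]] := of_wreathP x.
by rewrite inf_invE inf_mulE mulgV (inf_oneE n).
Qed.

HB.instance Definition _ :=
  isGroup.Build wreath_inf inf_mulA inf_mul1 inf_mulx1 inf_mulV inf_mulxV.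

Lemma of_wreathM n : {morph @of_wreath n : x y / x * y >-> x * y}.
Proof. by move=> x y; rewrite -inf_mulE. Qed.

(* The choice of representative is immaterial, by modtype_of_wreath. *)
Definition modtype (x : wreath_inf) : partfun gT :=
  wmodtype (tagged (repr x)).

Lemma modtype_of_wreath n (x : wreath gT n.+1) :
  modtype (of_wreath x) = wmodtype x.
Proof.
rewrite /modtype; set u := repr _.
have := of_wreath_repr (of_wreath x); rewrite -/u => /eqP.
have ln : n < (tag u + n).+1 by rewrite ltnS leq_addl.
have lu : tag u < (tag u + n).+1 by rewrite ltnS leq_addr.
rewrite (of_wreath_eq _ _ lu ln) => /eqP ex.
by rewrite -(wmodtype_embed lu) ex wmodtype_embed.
Qed.

Definition degree (x : wreath_inf) : nat := pnorm (modtype x).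

End WreathInf.

(* Main.v *)
Require Import Defs.
From mathcomp Require Import all_boot all_fingroup.

(** For [x = (g, sigma)] in [Gamma_n], the modified type has norm [n - b(x)],
    where [b(x)] is the number of balanced cycles of [sigma], those with
    cycle-product [1].  Hence the claim is [b(x) + b(y) <= n + b(x y)].

    Read [x] as the system of [n] equations [F i = g_i . F (sigma^-1 i)]
    (one for each [i]) on a function [F] from ['I_n] to the pointed free
    [Gamma]-set [T * Gamma + {0}].  An [F] that satisfies the systems of [x] and
    of [y] satisfies that of [x y].  Three facts conclude:
    - an equation can be imposed on [F], keeping those that already hold, by
      merging one [Gamma]-orbit of values of [F] into another or into [0]; this
      loses at most one of the nonzero orbits that [F] meets ([impose]);
    - in a balanced cycle one equation follows from the others, so the system of
      [x] is equivalent to [n - b(x)] equations ([sat_from_complement]);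
    - if [F] satisfies the system of [z], it meets at most one orbit on each cycle
      of [z], and none on an unbalanced one, so it meets at most [b(z)] nonzero
      orbits ([labels_balanced]).
    Starting from the free function [i |-> (i, 1)], which meets [n] orbits, and
    imposing the [n - b(x)] and [n - b(y)] equations leaves at least
    [b(x) + b(y) - n] orbits, and at most [b(x y)].

    These are the rank arguments of the frame matroid of a gain graph. *)

Set Implicit Arguments.
Unset Strict Implicit.
Unset Printing Implicit Defensive.

Import GroupScope.

Lemma set1_classes (gT : finGroupType) : [set 1] \in classes [set: gT].
Proof. by have := mem_classes (in_setT (1 : gT)); rewrite class1G. Qed.

(** The class [c^0]. *)
Definition trivial_class (gT : finGroupType) : conjclass gT :=
  Sub [set 1] (set1_classes gT).

(** * Systems of equations with gains in a group *)

Section Gains.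
Variables (gT : finGroupType) (T : finType) (n : nat).

(** The free [gT]-set on [T] with a fixed point [None] (the zero) added; the
    first component of a nonzero value, its label, names its orbit. *)
Definition gval := option (T * gT).

Definition scale (g : gT) (v : gval) : gval :=
  omap (fun p => (p.1, g * p.2)) v.

Implicit Types (F : 'I_n -> gval) (v w : gval) (t : T).

Lemma scale1 v : scale 1 v = v.
Proof. by case: v => // -[t h]; rewrite /= mul1g. Qed.

Lemma scaleM g h v : scale (g * h) v = scale g (scale h v).
Proof. by case: v => // -[t k]; rewrite /= mulgA. Qed.

(** The labels of the nonzero values of [F]. *)
Definition labels F : {set T} := [set t | [exists i, omap fst (F i) == Some t]].

Lemma labelsP F t : reflect (exists i, omap fst (F i) = Some t) (t \in labels F).
Proof.
by rewrite inE; apply: (iffP existsP) => -[i /eqP Fi]; exists i => //; apply/eqP.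
Qed.

(** The equivariant map that sends [(t, 1)] to [v] and fixes the other orbits. *)
Definition subst t v (w : gval) : gval :=
  if w is Some (s, h) then if s == t then scale h v else w else None.

Lemma substZ t v g w : subst t v (scale g w) = scale g (subst t v w).
Proof. by case: w => // -[s h] /=; case: eqP => // _; rewrite scaleM. Qed.

Lemma labels_subst t v F :
  #|labels F| <= #|labels (fun i => subst t v (F i))|.+1.
Proof.
rewrite -add1n (cardsD1 t); apply: leq_add; first exact: leq_b1.
apply: subset_leq_card; apply/subsetP=> s; rewrite in_setD1 => /andP[st].
case/labelsP=> i Fi; apply/labelsP; exists i; move: Fi.
by case: (F i) => // -[u h] /= [->]; rewrite (negbTE st).
Qed.

(** Every equation [F i = g . F j] can be made true by an equivariant
    substitution, at the price of at most one label. *)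
Lemma impose F i j g : exists F',
  [/\ F' i = scale g (F' j),
      forall k l h, F k = scale h (F l) -> F' k = scale h (F' l) &
      #|labels F| <= #|labels F'|.+1].
Proof.
suff [|[t [v eqF]]] : F i = scale g (F j) \/
    exists t v, subst t v (F i) = scale g (subst t v (F j)).
- by exists F; split.
- exists (fun k => subst t v (F k)); split=> // [k l h ->|].
    by rewrite substZ.
  exact: labels_subst.
case: (F i) (F j) => [[t h]|] [[u k]|]; last by left.
- have [<-|ne_tu] := eqVneq t u.
    (* Sending the common orbit of both values to the zero satisfies the
       equation whatever its gain is. *)
    by right; exists t, None; rewrite /= !eqxx.
  (* Otherwise the orbit of [F i] is merged into that of [F j]. *)
  right; exists t, (Some (u, h^-1 * (g * k))) => /=.
  by rewrite eqxx eq_sym (negbTE ne_tu) /= mulKVg.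
- by right; exists t, None; rewrite /= eqxx.
by right; exists u, None; rewrite /= eqxx.
Qed.

Lemma impose_seq F (s : seq 'I_n) (a : 'I_n -> gT) (p : 'I_n -> 'I_n) :
  exists F',
  [/\ {in s, forall i, F' i = scale (a i) (F' (p i))},
      forall k l h, F k = scale h (F l) -> F' k = scale h (F' l) &
      #|labels F| <= #|labels F'| + size s].
Proof.
elim: s => [|i s [F1 [sat1 keep1 le1]]]; first by exists F; rewrite addn0.
have [F2 [sat2 keep2 le2]] := impose F1 i (p i) (a i).
exists F2; split=> [j|k l h /keep1/keep2 //|].
  by rewrite inE => /predU1P[->//|/sat1/keep2].
by apply: leq_trans le1 _; rewrite /= addnS -addSn leq_add2r.
Qed.

(** * The system attached to an element of the wreath product *)

(** The equation of [x] at [i]; all of them hold exactly when [F] is fixed by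
    the action of [x] on functions. *)
Definition sat_at F (x : wreath gT n) i :=
  F i = scale (wcoord x i) (F ((wperm x)^-1 i)).

Lemma satM F (x y : wreath gT n) :
  (forall i, sat_at F x i) -> (forall i, sat_at F y i) ->
  forall i, sat_at F (x * y) i.
Proof.
move=> sx sy i; rewrite /sat_at wcoordM wpermM invMg permM scaleM.
by rewrite -sy -sx.
Qed.

Lemma sat_perm F (x : wreath gT n) i : sat_at F x (wperm x i) ->
  F (wperm x i) = scale (wcoord x (wperm x i)) (F i).
Proof. by rewrite /sat_at permK. Qed.

(** The cycles with cycle-product [1]. *)
Definition balanced (x : wreath gT n) : {set {set 'I_n}} :=
  [set C in porbits (wperm x) | [exists i in C, cycle_prod x i == 1]].

Lemma cycle_prod1 (x : wreath gT n) i j : j \in porbit (wperm x) i ->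
  (cycle_prod x j == 1) = (cycle_prod x i == 1).
Proof.
by move=> ij; have := cycle_prod_class (trivial_class gT) ij; rewrite !inE.
Qed.

Lemma mem_balanced (x : wreath gT n) i :
  (porbit (wperm x) i \in balanced x) = (cycle_prod x i == 1).
Proof.
rewrite inE imset_f //=; apply/exists_inP/idP => [[j ij]|i1].
  by rewrite (cycle_prod1 ij).
by exists i => //; exact: porbit_id.
Qed.

(** Composing the equations met by following the cycle from [i]. *)
Lemma sat_traject F (x : wreath gT n) i k :
  (forall m, m < k -> sat_at F x (iter m.+1 (wperm x) i)) ->
  F (iter k (wperm x) i) =
    scale (\prod_(j <- rev (traject (wperm x) (wperm x i) k)) wcoord x j) (F i).
Proof.
elim: k => [|k IHk] sat; first by rewrite big_nil scale1.
rewrite iterS sat_perm; last exact: (sat k).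
rewrite IHk => [|m lt_mk]; last by apply: sat; apply: ltnW.
by rewrite -scaleM trajectSr rev_rcons big_cons -iterSr.
Qed.

(** The equations along the cycle of [i], except the one at [i] itself, give the
    value at the last point of the cycle in terms of the value at [i]. *)
Lemma sat_cycle (x : wreath gT n) i : exists2 p,
  cycle_prod x i = p * wcoord x i &
  forall F, {in porbit (wperm x) i, forall j, j != i -> sat_at F x j} ->
    F ((wperm x)^-1 i) = scale p (F i).
Proof.
set s := wperm x; have itk := iter_porbit s i.
have := uniq_traject_porbit s i; move: itk; rewrite /cycle_prod -/s.
case: #|_| (card_porbit_neq0 s i) => // k _.
rewrite trajectS rev_cons -cats1 big_cat big_seq1 => itk /andP[iN _].
eexists; first by [].
move=> F sat; rewrite -sat_traject => [|m lt_mk]; last first.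
  apply: sat; first by rewrite -permX mem_porbit.
  apply: contraNneq iN => it_m; apply/trajectP.
  by exists m; rewrite // -iterSr it_m.
by congr (F _); apply: (@perm_inj _ s); rewrite permKV -iterS.
Qed.

(** In a balanced cycle, the equations away from [i] imply the one at [i]. *)
Lemma sat_balanced F (x : wreath gT n) i : cycle_prod x i = 1 ->
  {in porbit (wperm x) i, forall j, j != i -> sat_at F x j} -> sat_at F x i.
Proof.
have [p -> satp] := sat_cycle x i => /eqP; rewrite -eq_invg_mul => /eqP pg.
by move=> /satp eqF; rewrite /sat_at eqF -scaleM -pg mulVg scale1.
Qed.

(** [R] holds one point of each balanced cycle; the other points carry
    [n - b(x)] equations that imply the whole system. *)
Lemma sat_from_complement (x : wreath gT n) : exists R : {set 'I_n},
  #|R| = #|balanced x| /\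
  forall F, {in ~: R, forall i, sat_at F x i} -> forall i, sat_at F x i.
Proof.
(* [pick] returns the same point from every point of a cycle. *)
pose R := [set i | (cycle_prod x i == 1) &&
                   ([pick j in porbit (wperm x) i] == Some i)].
exists R.
have porbit_eq i j : j \in porbit (wperm x) i ->
    porbit (wperm x) j = porbit (wperm x) i.
  by move=> ij; apply/eqP; rewrite eq_porbit_mem.
have R_inj : {in R &, injective (porbit (wperm x))}.
  move=> i j; rewrite !inE => /andP[_ /eqP pi] /andP[_ /eqP pj] ij.
  by apply: Some_inj; rewrite -pi -pj ij.
split=> [|F sat i].
  rewrite -(card_in_imset R_inj); apply: eq_card => C.
  apply/imsetP/idP => [[i + ->]|]; first by rewrite mem_balanced inE => /andP[].
  move=> CB; have := CB; rewrite inE => /andP[/imsetP[i _ def_C] _].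
  move: CB; rewrite def_C mem_balanced => i1.
  case pick_i: [pick j in porbit (wperm x) i] => [j|]; last first.
    by case: pickP pick_i => // /(_ i); rewrite porbit_id.
  have ij : j \in porbit (wperm x) i by case: pickP pick_i => // k ik [<-].
  by exists j; rewrite ?inE (porbit_eq _ _ ij) // (cycle_prod1 ij) i1 pick_i /=.
have [iR|iR] := boolP (i \in R); last by apply: sat; rewrite inE.
have := iR; rewrite inE => /andP[/eqP i1 _].
apply: sat_balanced i1 _ => j ij ne_ji; apply: sat; rewrite inE.
by apply: contra ne_ji => jR; apply/eqP/R_inj; rewrite ?(porbit_eq _ _ ij).
Qed.

(** On a cycle of [x] the label is constant.  Going once around the cycle
    multiplies the value of [F] by a conjugate of the cycle-product, so that the
    cycle is balanced when the value is nonzero, the action being free. *)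
Lemma labels_balanced F (x : wreath gT n) :
  (forall i, sat_at F x i) -> #|labels F| <= #|balanced x|.
Proof.
move=> sat; set s := wperm x.
have label_porbit i j : j \in porbit s i -> omap fst (F j) = omap fst (F i).
  case/porbitP=> k ->; rewrite permX sat_traject //; by case: (F i).
pose lab (C : {set 'I_n}) :=
  if [pick j in C] is Some j then omap fst (F j) else None.
(* [lab] maps the balanced cycles onto a set that contains all labels of [F]. *)
rewrite -(card_imset _ (@Some_inj _)).
apply: leq_trans (leq_imset_card lab _); apply: subset_leq_card.
apply/subsetP=> _ /imsetP[t /labelsP[i Fi] ->]; apply/imsetP.
exists (porbit s i); last first.
  rewrite /lab; case: pickP => [j /label_porbit->//|/(_ i)].
  by rewrite porbit_id.
have [p def_p satp] := sat_cycle x i.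
have := sat i; rewrite /sat_at satp // -scaleM mem_balanced def_p.
case: (F i) Fi => // -[u h] /= _ [/esym/(canRL (mulgK h))].
by rewrite mulgV => /(canRL (mulKg _)) ->; rewrite mulg1 mulVg.
Qed.

End Gains.

(** * The norm of the modified type *)

Section Norm.
Variable gT : finGroupType.

Lemma sumn_mkpart s : sumn (mkpart s) = sumn s.
Proof.
rewrite (perm_sumn (permEl (perm_sort _ _))).
by elim: s => //= -[|k] s IHs //=; rewrite IHs.
Qed.

Variables (n : nat) (x : wreath gT n).

Lemma sumn_wtype c : sumn (wtype x c) = \sum_(C in cycles_in x c) #|C|.
Proof. by rewrite ffunE sumn_mkpart sumnE big_map big_enum. Qed.

Lemma cycles_in_balanced (c : conjclass gT) :
  val c = [set 1] -> cycles_in x c = balanced x.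
Proof.
move=> c1; apply/setP=> C; rewrite !inE c1; congr andb.
by apply: eq_existsb => i; rewrite inE.
Qed.

Lemma sumn_wmodtype c : sumn (wmodtype x c) + (val c == [set 1]) * #|balanced x|
  = \sum_(C in cycles_in x c) #|C|.
Proof.
rewrite ffunE -sumn_wtype; case: eqP => [/cycles_in_balanced <-|_]; last first.
  by rewrite mul0n addn0.
have sumn_pred s : 0 \notin s -> sumn (map predn s) + size s = sumn s.
  elim: s => //= -[|k] s IHs; rewrite inE //= => /IHs <-.
  by rewrite addnS -addnA.
rewrite mul1n sumn_mkpart -[RHS]sumn_pred; last first.
  by case/andP: (partsP (wtype x c)).
congr (_ + _); rewrite ffunE size_sort size_filter count_map count_enum_set.
apply: eq_card => C; rewrite !inE /=; case: imsetP => //= -[i _ ->].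
by rewrite lt0n card_porbit_neq0 andbT.
Qed.

Lemma porbits_partition (s : {perm 'I_n}) : partition (porbits s) setT.
Proof.
have actS : [acts <[s]>, on setT | 'P].
  by apply/subsetP=> a _; rewrite !inE; apply/subsetP=> i; rewrite !inE.
rewrite (_ : porbits s = orbit 'P <[s]> @: setT) ?orbit_partition //.
apply/setP=> C; apply/imsetP/imsetP => -[i _ ->];
  by exists i; rewrite ?inE ?porbitE.
Qed.

(** Each cycle of [x] lies in [cycles_in x c] for exactly one class [c]. *)
Lemma sum_cycles_in :
  \sum_(c : conjclass gT) \sum_(C in cycles_in x c) #|C| = n.
Proof.
rewrite (exchange_big_dep (mem (porbits (wperm x)))) /=; last first.
  by move=> c C _; rewrite inE => /andP[].
rewrite -[RHS]card_ord -cardsT (card_partition (porbits_partition (wperm x))).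
apply: eq_bigr => _ /imsetP[i _ ->].
pose ci : conjclass gT :=
  Sub (cycle_prod x i ^: [set: gT]) (mem_classes (in_setT (cycle_prod x i))).
rewrite (big_pred1 ci) // => c; rewrite mem_cycles_in /= -val_eqE /=.
case: c => _ /= /imsetP[g _ ->].
by apply/class_eqP/eqP => ->.
Qed.

Lemma pnorm_wmodtype : pnorm (wmodtype x) + #|balanced x| = n.
Proof.
apply: etrans sum_cycles_in.
rewrite -(eq_bigr _ (fun c _ => sumn_wmodtype c)) big_split /=.
congr (_ + _).
rewrite (bigD1 (trivial_class gT)) //= eqxx mul1n big1 ?addn0 // => c.
by rewrite -val_eqE /= => /negbTE->.
Qed.

End Norm.

(** * Subadditivity of the degree *)

Lemma balancedM (gT : finGroupType) n (x y : wreath gT n) :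
  #|balanced x| + #|balanced y| <= n + #|balanced (x * y)|.
Proof.
have [Rx [<- satRx]] := sat_from_complement 'I_n x.
have [Ry [<- satRy]] := sat_from_complement 'I_n y.
pose F0 (i : 'I_n) : gval gT 'I_n := Some (i, 1).
have [F1 [sat1 _ le1]] := impose_seq F0 (enum (~: Rx)) (wcoord x) (wperm x)^-1.
have [F2 [sat2 keep le2]] := impose_seq F1 (enum (~: Ry)) (wcoord y) (wperm y)^-1.
have satx : forall i, sat_at F2 x i.
  by apply: satRx => i iR; apply/keep/sat1; rewrite mem_enum.
have saty : forall i, sat_at F2 y i.
  by apply: satRy => i iR; apply: sat2; rewrite mem_enum.
have labels0 : #|labels F0| = n.
  suff -> : labels F0 = setT by rewrite cardsT card_ord.
  by apply/setP=> i; rewrite in_setT; apply/labelsP; exists i.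
have le3 := labels_balanced (satM satx saty).
rewrite -cardE in le1; rewrite -cardE in le2.
have := leq_trans le1 (leq_add (leq_trans le2 (leq_add le3 (leqnn _))) (leqnn _)).
rewrite labels0 => le_n; rewrite -(leq_add2r (#|~: Rx| + #|~: Ry|)).
rewrite addnACA !cardsC !card_ord.
by rewrite -addnA leq_add2l (leq_trans le_n) // -addnA (addnC #|~: Ry|).
Qed.

Lemma pnormM (gT : finGroupType) n (x y : wreath gT n) :
  pnorm (wmodtype (x * y)) <= pnorm (wmodtype x) + pnorm (wmodtype y).
Proof.
rewrite -(leq_add2r (#|balanced x| + #|balanced y|)) addnACA !pnorm_wmodtype.
apply: leq_trans (_ : pnorm (wmodtype (x * y)) + (n + #|balanced (x * y)|) <= _).
  by rewrite leq_add2l balancedM.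
by rewrite addnCA pnorm_wmodtype.
Qed.

Theorem lemma2p8 (gT : finGroupType) (x y : wreath_inf gT)
    (lambda mu nu : partfun gT) :
  modtype x = lambda -> modtype y = mu -> modtype (x * y)%g = nu ->
  (degree (x * y)%g <= degree x + degree y)%N /\
  (pnorm nu <= pnorm lambda + pnorm mu)%N.
Proof.
move=> <- <- <-; rewrite /degree.
suff le_xy : pnorm (modtype (x * y)) <= pnorm (modtype x) + pnorm (modtype y).
  by [].
have [n [x' [y' [_ [-> -> _]]]]] := of_wreath3 x y x.
by rewrite -of_wreathM !modtype_of_wreath pnormM.
Qed.
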